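(* Let $m\geq 9$ be an integer and let $G$ be a graph with $m$ edges. If $\mu(G)>\sqrt{m}$, then $G$ has a $4$-cycle, i.e. $G$ contains a (not necessarily induced) cycle of length $4$ as a subgraph.
   Context: Graphs are finite, simple and undirected. For a graph $G$, $\mu(G)$ denotes the spectral radius of its adjacency matrix, which is the largest eigenvalue of the adjacency matrix. *)

(* Defs.v *)
From HB Require Import structures.
From mathcomp Require Import all_boot all_order all_algebra.
From mathcomp Require Import complex.
From mathcomp Require Import classical_sets reals.

Set Implicit Arguments.
Unset Strict Implicit.
Unset Printing Implicit Defensive.

Import Order.TTheory GRing.Theory Num.Theory.

Local Open Scope ring_scope.

(* A simple graph is a symmetric irreflexive relation [e] on a finite type
   [T] of vertices; its edges are the 2-element sets [{x, y}] with [e x y]. *)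
Definition edge_set (T : finType) (e : rel T) : {set {set T}} :=
  [set [set p.1; p.2] | p : T * T & e p.1 p.2].

(* The vertices are numbered along [enum T]; eigenvalues do not depend on the
   numbering. *)
Definition adjmx (R : realType) (T : finType) (e : rel T) : 'M[R]_#|T| :=
  \matrix_(i, j) (e (enum_val i) (enum_val j))%:R.

(* The largest modulus of a complex eigenvalue. The set of eigenvalues is
   finite, so the supremum is a maximum (and is 0 for the 0 x 0 matrix). For the
   adjacency matrix of a graph, it is also the largest eigenvalue. *)
Definition spectral_radius (R : realType) (n : nat) (A : 'M[R]_n) : R :=
  sup [set r | exists2 z : R[i],
                 eigenvalue (map_mx (real_complex R) A) z
               & r = ComplexField.Normc.normc z]%classic.

(* The subgraph need not be induced. Meaningful for [2 < k]: an edge is a [ucycle]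
   of size 2. *)
Definition has_cycle (T : finType) (e : rel T) (k : nat) : Prop :=
  exists c : seq T, size c = k /\ ucycle e c.

(* Main.v *)
Require Import Defs.
From HB Require Import structures.
From mathcomp Require Import all_boot all_order all_algebra.
From mathcomp Require Import complex.
From mathcomp Require Import classical_sets reals.
From mathcomp Require Import lra.

Import Order.TTheory GRing.Theory Num.Theory.

Local Open Scope ring_scope.

(** A complex eigenvector for an eigenvalue of modulus [l > sqrt m] yields, by
    taking moduli, a nonnegative [w] with [A w >= l w]. Scale [w] so that its
    maximum is [w u = 1] and let [N] be the neighbourhood of [u], [W] the set of
    vertices outside [N] and [u], and [c y] the number of common neighbours of
    [u] and [y]. Without 4-cycles, [c y <= 1] for [y <> u]. Put
    [M = \sum_(N) c w] and [Y = \sum_(W) c w]. Applying [A w >= l w] twice at [u]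
    gives [l^2 <= deg u + M + Y]; applying it on [N] gives
    [(l - 1) M <= 2 e(N) + Y]; applying it on [W] gives
    [l Y <= e(N, W) + 2 e(W)]. As [l >= 3], these add up to
    [l^2 <= deg u + e(N) + e(N, W) / 2 + e(W) <= m]. *)

(** Map each ordered pair to the set of its entries: the fibre over an edge [{a, b}] contains at
    most [(a, b)] and [(b, a)]. *)
Lemma sum_adj_le_edges (T : finType) (e : rel T) :
  (\sum_x \sum_y e x y <= 2 * #|edge_set e|)%N.
Proof.
pose D : {set T * T} := [set p | e p.1 p.2].
have -> : edge_set e = [set [set p.1; p.2] | p in D].
  by apply/setP => E; apply/imsetP/imsetP => -[p]; rewrite ?inE => ep ->;
    exists p; rewrite ?inE.
rewrite pair_bigA /= -big_mkcond /= mulnC -sum_nat_const.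
rewrite (eq_bigl [in D]) => [|p]; last by rewrite inE.
rewrite (partition_big_imset (fun p : T * T => [set p.1; p.2])) /=.
apply: leq_sum => E /imsetP[[a b] _ ->] /=.
rewrite sum1_card -[2%N]/((size [:: (a, b); (b, a)])).
apply: leq_trans (card_size _); apply: subset_leq_card.
apply/fintype.subsetP => -[x y]; rewrite !inE => /andP[_ /eqP /= E1].
have /set2P xab : x \in [set a; b] by rewrite -E1 set21.
have /set2P yab : y \in [set a; b] by rewrite -E1 set22.
have /set2P axy : a \in [set x; y] by rewrite E1 set21.
have /set2P bxy : b \in [set x; y] by rewrite E1 set22.
rewrite !xpair_eqE; case: xab yab axy bxy => -> [] -> [] ? [] ?; subst;
  by rewrite !eqxx ?orbT.
Qed.

Lemma has_cycle4 (T : finType) (e : rel T) (u y : T) :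
    symmetric e -> irreflexive e -> y != u ->
  (1 < #|[set a | e u a && e a y]|)%N -> has_cycle e 4.
Proof.
move=> e_sym e_irr yu /card_gt1P[a [b [+ + ab]]].
rewrite !inE => /andP[ua ay] /andP[ub yb].
have neq s t : e s t -> s != t by apply: contraTneq => ->; rewrite e_irr.
exists [:: u; a; y; b]; split=> //; apply/andP; split.
  by rewrite /= ua ay [e y b]e_sym yb [e b u]e_sym ub.
by rewrite /= !inE !negb_or (neq _ _ ua) [u == y]eq_sym yu (neq _ _ ub)
  (neq _ _ ay) ab [y == b]eq_sym (neq _ _ yb).
Qed.

Lemma subeigen_sqr_le_edges (R : realFieldType) (T : finType) (e : rel T)
    (u : T) (w : T -> R) (l : R) :
    symmetric e -> irreflexive e ->
    (forall y, y != u -> (#|[set a | e u a && e a y]| <= 1)%N) ->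
    (forall x, 0 <= w x <= 1) -> w u = 1 -> 3 <= l ->
    (forall x, l * w x <= \sum_y (e x y)%:R * w y) ->
  l ^+ 2 <= #|edge_set e|%:R.
Proof.
move=> e_sym e_irr codeg w01 wu l3 lw.
have w0 x : 0 <= w x by case/andP: (w01 x).
have w1 x : w x <= 1 by case/andP: (w01 x).
pose A x y : R := (e x y)%:R.
have A0 x y : 0 <= A x y by rewrite ler0n.
have AC x y : A x y = A y x by rewrite /A e_sym.
pose N := e u; pose W y := ~~ e u y && (y != u).
have splitE (F : T -> R) :
    \sum_y F y = F u + \sum_(y | N y) F y + \sum_(y | W y) F y.
  rewrite (bigID N) /= [X in _ + X](bigD1 u) /= ?/N ?e_irr //.
  by rewrite addrCA addrA.
pose c y := \sum_(a | N a) A a y.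
have c0 y : 0 <= c y by apply: sumr_ge0.
have c1 y : y != u -> c y <= 1.
  move=> /codeg; rewrite /c /A -natr_sum -big_mkcondr sum1dep_card /=.
  by rewrite -(ler_nat R).
have cu1 : \sum_(a | N a) 1 = c u.
  by apply: eq_bigr => a; rewrite /A e_sym /N => ->.
have NAu a : N a -> A a u = 1 by rewrite /A e_sym /N => ->.
have WAu a : W a -> A a u = 0.
  by rewrite /A e_sym => /andP[/negPf->].
have Nu a : N a -> a != u by apply: contraTneq => ->; rewrite /N e_irr.
have Wu a : W a -> a != u by case/andP.
have cE x : \sum_(b | N b) A x b = c x by apply: eq_bigr => b _.
pose M := \sum_(a | N a) c a * w a; pose Y := \sum_(y | W y) c y * w y.
(* In the notation of the overview these are [2 e(N)], [e(N, W)] and [2 e(W)], while [c u] is the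
   degree of [u]. *)
pose cN := \sum_(a | N a) c a; pose q := \sum_(y | W y) c y.
pose r := \sum_(y | W y) \sum_(z | W z) A y z.
have M0 : 0 <= M by apply: sumr_ge0 => a _; rewrite mulr_ge0.
have Y0 : 0 <= Y by apply: sumr_ge0 => a _; rewrite mulr_ge0.
have lu : l ^+ 2 <= c u + M + Y.
  have -> : c u + M + Y = \sum_y c y * w y by rewrite [RHS]splitE /= wu mulr1.
  have l0 : 0 <= l by lra.
  apply: (@le_trans _ _ (l * \sum_(a | N a) w a)).
    rewrite expr2 ler_wpM2l // -[leLHS]mulr1 -wu; apply: le_trans (lw u) _.
    rewrite [leRHS]big_mkcond; apply: ler_sum => y _.
    by rewrite /N; case: (e u y); rewrite ?mul1r ?mul0r.
  rewrite mulr_sumr; under [leRHS]eq_bigr do rewrite mulr_suml.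
  by rewrite exchange_big /=; apply: ler_sum => a _; apply: lw.
have lM : l * M <= cN + M + Y.
  rewrite mulr_sumr.
  have -> : M = \sum_(a | N a) \sum_(b | N b) A a b * w b.
    by rewrite exchange_big /=; apply: eq_bigr => b _; rewrite -mulr_suml.
  have -> : Y = \sum_(a | N a) \sum_(y | W y) A a y * w y.
    by rewrite exchange_big /=; apply: eq_bigr => b _; rewrite -mulr_suml.
  rewrite -!big_split /=; apply: ler_sum => a Na.
  rewrite mulrCA; apply: le_trans (ler_wpM2l (c0 a) (lw a)) _.
  (* The factor [c a <= 1] is kept on the term of [u], where it adds up to [cN], and bounded by 1 on
     the others. *)
  rewrite [in leLHS]splitE wu mulr1 -!/(A _ _) NAu // -!addrA mulrDr mulr1 lerD2l.
  apply: ler_piMl; last exact: c1 (Nu _ Na).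
  by apply: addr_ge0; apply: sumr_ge0 => y _; rewrite mulr_ge0.
have lY : l * Y <= q + r.
  rewrite mulr_sumr -big_split /=; apply: ler_sum => y Wy.
  have cy1 := c1 _ (Wu _ Wy).
  rewrite mulrCA; apply: le_trans (ler_wpM2l (c0 y) (lw y)) _.
  (* The term of [u] vanishes. The sum over [N] is at most [c y <= 1], which leaves the outer [c y]
     to add up to [q]; on [W] the outer [c y] is bounded by 1 instead. *)
  rewrite splitE -!/(A _ _) WAu // mul0r add0r mulrDr lerD //.
    apply: ler_piMr => //; apply: le_trans cy1; rewrite -cE.
    by apply: ler_sum => b _; apply: ler_piMr.
  apply: (@le_trans _ _ (\sum_(z | W z) A y z * w z)).
    by apply: ler_piMl => //; apply: sumr_ge0 => z _; rewrite mulr_ge0.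
  by apply: ler_sum => z _; apply: ler_piMr.
have q0 : 0 <= q by apply: sumr_ge0.
(* Adjacency splits into blocks over [u], [N] and [W]: the two off-diagonal ones count twice, and no
   edge joins [u] to [W]. *)
have total : \sum_x \sum_y A x y = 2 * c u + cN + 2 * q + r.
  under eq_bigr do rewrite splitE cE.
  rewrite !big_split /=.
  have -> : \sum_x A x u = c u.
    by rewrite /c [RHS]big_mkcond; apply: eq_bigr => x _; rewrite /A e_sym /N; case: (e u x).
  rewrite !splitE -/cN -/q -/r.
  have -> : \sum_(y | W y) A u y = 0.
    by apply: big1 => y Wy; rewrite AC WAu.
  have -> : \sum_(x | N x) \sum_(y | W y) A x y = q by rewrite exchange_big.
  by lra.
have : \sum_x \sum_y A x y <= 2 * #|edge_set e|%:R.
  rewrite -natrM; under eq_bigr do rewrite -natr_sum.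
  by rewrite -natr_sum ler_nat sum_adj_le_edges.
rewrite total.
(* These products make the rest linear: [2 M <= cN + Y] and [3 Y <= q + r] give
   [M + Y <= (cN + q + r) / 2], and [q0] absorbs the missing [q / 2]. *)
have := mulr_ge0 M0 (_ : 0 <= l - 3); have := mulr_ge0 Y0 (_ : 0 <= l - 3).
rewrite subr_ge0 => /(_ l3) ? /(_ l3) ?.
by lra.
Qed.

(** By the triangle inequality, the moduli of the entries of an eigenvector satisfy the eigenvalue
    equation as an inequality. *)
Lemma spectral_radius_subeigen (R : realType) (T : finType) (e : rel T) (s : R) :
    symmetric e -> 0 <= s -> s < spectral_radius (adjmx R e) ->
  exists l (w : T -> R), [/\ s < l, forall x, 0 <= w x, exists x, w x != 0 &
    forall x, l * w x <= \sum_y (e x y)%:R * w y].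
Proof.
move=> e_sym s0; rewrite /spectral_radius; set S := mkset _ => sS.
(* The supremum of the empty set is 0, which [0 <= s] excludes. *)
have [S0|/set0P S0] := eqVneq S set0.
  by move: sS; rewrite S0 sup0 ltNge s0.
have [_ [z /eigenvalueP[v vz v0] ->] sz] := sup_gt S0 sS.
exists (ComplexField.Normc.normc z).
exists (fun x => ComplexField.Normc.normc (v 0 (enum_rank x))); split=> //.
- by move=> x; rewrite -(@lecR R) (normr_ge0 (v 0 (enum_rank x))).
- have /rV0Pn[i vi] := v0; exists (enum_val i); rewrite enum_valK.
  by apply: contraNneq vi => /ComplexField.Normc.eq0_normc ->.
have normE (t : R[i]) : (ComplexField.Normc.normc t)%:C%C = `|t| by [].
move=> x; rewrite -(@lecR R) rmorphM rmorph_sum /= !normE -normrM.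
(* Eigenvectors are row vectors here, so symmetry of [e] turns columns into rows. *)
have -> : z * v 0 (enum_rank x) = \sum_i v 0 i * (e x (enum_val i))%:R.
  have /rowP/(_ (enum_rank x)) := vz; rewrite !mxE => <-.
  by apply: eq_bigr => i _; rewrite !mxE enum_rankK rmorph_nat e_sym.
apply: le_trans (ler_norm_sum _ _ _) _.
rewrite (reindex enum_rank) /=; last by apply: onW_bij; apply: enum_rank_bij.
apply: ler_sum => y _.
by rewrite enum_rankK normrM normr_nat mulrC rmorphM rmorph_nat.
Qed.

Theorem theorem2 (R : realType) (m : nat) (hm : (9 <= m)%N)
    (T : finType) (e : rel T) (e_sym : symmetric e) (e_irr : irreflexive e)
    (e_size : #|edge_set e| = m)
    (mu_gt : Num.sqrt (m%:R : R) < spectral_radius (adjmx R e)) :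
  has_cycle e 4.
Proof.
have [l [w [ml w0 [x0 wx0] lw]]] :=
  spectral_radius_subeigen _ _ _ _ e_sym (sqrtr_ge0 _) mu_gt.
have [u _ wu] := @arg_maxP _ _ T x0 xpredT w isT.
have wu0 : 0 < w u by apply: lt_le_trans (wu x0 isT); rewrite lt_def wx0 w0.
have [/forallP codeg|] :=
  boolP [forall y, (y != u) ==> (#|[set a | e u a && e a y]| <= 1)%N]; last first.
  move=> /forallPn[y]; rewrite negb_imply -ltnNge => /andP[].
  exact: has_cycle4.
(* The bound [9 <= m] enters here, through [3 <= sqrt m < l]. *)
have l3 : 3 <= l.
  apply: le_trans (ltW ml); rewrite -(@ler_pXn2r _ 2) ?nnegrE ?sqrtr_ge0 //.
  by rewrite sqr_sqrtr ?ler0n // -natrX ler_nat.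
suff : l ^+ 2 <= m%:R.
  by rewrite leNgt -[m%:R]sqr_sqrtr ?ler0n // ltr_pXn2r ?nnegrE ?sqrtr_ge0 ?ml //; lra.
rewrite -e_size; apply: (@subeigen_sqr_le_edges R T e u (fun x => w x / w u)) => //.
- by move=> y yu; apply: (implyP (codeg y)).
- move=> x; rewrite divr_ge0 ?w0 //= ler_pdivrMr // mul1r; exact: wu.
- by rewrite divff // gt_eqF.
move=> x; rewrite mulrA ler_pdivrMr // mulr_suml; apply: le_trans (lw x) _.
by apply: ler_sum => y _; rewrite -mulrA divfK // gt_eqF.
Qed.
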